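(* Let $C$ be the class of all ultrafilters $u$ on $\omega$ for which there exists $\alpha<\omega_1$ such that $u$ is a $J_\alpha$-ultrafilter. Then $C$ is closed under $C$-sums: if $u\in C$ and $v_n\in C$ for all $n<\omega$, then $\sum_u\langle v_n:n<\omega\rangle\in C$.
   Context: For $\alpha\le\omega_1$ let $J_\alpha=\{Y\subseteq\omega_1:\operatorname{tp}Y<\alpha\}$, where $\operatorname{tp}Y$ is the order type of $Y$. An ultrafilter $u$ on $\omega$ is a $J_\alpha$-ultrafilter if for every $F:\omega\to\omega_1$ there is $A\in u$ with $F(A)\in J_\alpha$. If $u$ and $v_n$ ($n<\omega$) are ultrafilters on $\omega$, then $\sum_u\langle v_n:n<\omega\rangle$ is the ultrafilter on $\omega\times\omega$ consisting of all $Z\subseteq\omega\times\omega$ with $\{n:\{m:(n,m)\in Z\}\in v_n\}\in u$; it is regarded as an ultrafilter on $\omega$ via a bijection $\omega\times\omega\to\omega$ (isomorphic ultrafilters are identified). *)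

(* Defs.v *)
From HB Require Import structures.
From mathcomp Require Import all_boot all_order.
From mathcomp Require Import boolp classical_sets functions cardinality filter.
From mathcomp Require wochoice.

Set Implicit Arguments.
Unset Strict Implicit.
Unset Printing Implicit Defensive.

Import Order.TTheory.

Local Open Scope classical_set_scope.
Local Open Scope order_scope.

(* A well-ordered set W is a copy of omega_1 iff it is uncountable and all its
   proper initial segments are countable; such a W exists (see omega1_exists)
   and is unique up to a unique isomorphism. *)
Record is_omega1 d (W : orderType d) : Prop := IsOmega1 {
  omega1_wf : well_founded (fun x y : W => x < y);
  omega1_uncountable : ~ countable [set: W];
  omega1_initial : forall a : W, countable [set b : W | b < a]
}.

Section OrderTypes.
Context d (W : orderType d).

(* An ordinal alpha <= omega_1 is encoded in option W: Some a is the countable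
   ordinal a, and None is omega_1 itself. [ordinals_below alpha] is the set of
   all beta < alpha, i.e. alpha as a von Neumann ordinal. *)
Definition ordinals_below (alpha : option W) : set W :=
  if alpha is Some a then [set b | b < a] else setT.

Definition order_isomorphic (A B : set W) : Prop :=
  exists2 f : W -> W, set_bij A B f & {in A &, {mono f : x y / x <= y}}.

Definition has_order_type (Y : set W) (alpha : option W) : Prop :=
  order_isomorphic Y (ordinals_below alpha).

(* tp Y < alpha; every beta < alpha <= omega_1 is a countable ordinal. *)
Definition J (alpha : option W) : set (set W) :=
  [set Y | exists2 beta : W,
     ordinals_below alpha beta & has_order_type Y (Some beta)].

Definition J_ultrafilter (alpha : option W) (u : set_system nat) : Prop :=
  UltraFilter u /\
  forall F : nat -> W, exists2 A : set nat, u A & J alpha (F @` A).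

End OrderTypes.

Definition classC d (W : orderType d) : set (set_system nat) :=
  [set u | exists alpha : W, J_ultrafilter (Some alpha) u].

Definition ultrafilter_sum (u : set_system nat) (v : nat -> set_system nat) :
    set_system (nat * nat) :=
  [set Z | u [set n | v n [set m | Z (n, m)]]].

Lemma uncountable_set_nat : ~ countable [set: set nat].
Proof.
move=> /countable_injP[f finj].
pose D := [set n | exists2 A : set nat, f A = n & ~ A n].
have [DD|nDD] := pselect (D (f D)); last by apply: (nDD); exists D.
by case: (DD) => A /finj; rewrite !in_setT => /(_ isT isT) ->; apply.
Qed.

(* The points with countably many predecessors in a well-ordering of the
   powerset of nat form a copy of omega_1. *)
Lemma omega1_exists : exists d (W : orderType d), is_omega1 W.
Proof.
pose U := {classic (set nat)}.
have [R Rwo] := wochoice.well_ordering_principle U.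
have Rmin (A : set U) : A !=set0 -> exists2 z, A z & forall x, A x -> R z x.
  move=> [a Aa].
  have [|z [[zA zmin] _]] := Rwo (mem A); first by exists a; exact: mem_set.
  exists z; first exact: set_mem zA.
  by move=> x Ax; apply: zmin; exact: mem_set.
have Rchain : wochoice.wo_chain R (mem predT) by move=> A _; exact: Rwo.
have Rtot : total R.
  by move=> x y; exact: (wochoice.wo_chainW Rchain).
have Ranti : antisymmetric R.
  by move=> x y; apply: (wochoice.wo_chain_antisymmetric Rchain).
have Rtrans : transitive R.
  move=> y x z xy yz.
  have [t txyz tmin] : exists2 t, [set x; y; z] t
      & forall w, [set x; y; z] w -> R t w.
    by apply: Rmin; exists x; left; left.
  have tx : R t x by apply: tmin; left; left.
  have ty : R t y by apply: tmin; left; right.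
  have tz : R t z by apply: tmin; right.
  case: txyz => [[tx'|ty']|tz']; first by rewrite -tx'.
    by rewrite (Ranti x y) ?xy// -ty'.
  by rewrite -(Ranti y z) ?yz -?tz'.
pose P (x : U) : bool := `[< countable [set y | y != x /\ R y x] >].
pose S := {x : U | P x}.
pose le (x y : S) := R (val x) (val y).
pose lt (x y : S) := (y != x) && le x y.
pose meet (x y : S) := if lt x y then x else y.
pose join (x y : S) := if lt x y then y else x.
have le_anti : antisymmetric le by move=> x y /Ranti /val_inj.
have le_trans : transitive le by move=> y x z; exact: Rtrans.
have le_total : total le by move=> x y; exact: Rtot.
pose W : orderType (Order.Disp tt tt) := HB.pack S
  (@Order.isOrder.Build (Order.Disp tt tt) S le lt meet join
    (fun _ _ => erefl) (fun _ _ => erefl) (fun _ _ => erefl)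
    le_anti le_trans le_total).
exists (Order.Disp tt tt), W; split.
- move=> a; apply: contrapT => nAcca.
  have [_ [z nAccz <-] zmin] :
      exists2 z, [set val x | x in [set x : S | ~ Acc lt x]] z
        & forall w, [set val x | x in [set x : S | ~ Acc lt x]] w -> R z w.
    by apply: Rmin; exists (val (a : S)); exists a.
  apply: nAccz; split=> y /andP[zy yz]; apply: contrapT => nAccy.
  have zy' : le z y by apply: zmin; exists y.
  by rewrite (le_anti z y) ?eqxx// in zy; rewrite zy' yz.
- move=> Wcount.
  have valcount : countable [set x | P x].
    have -> : [set x | P x] = [set val x | x in [set: S]].
      apply/seteqP; split=> [x Px|_ [x _ <-]]; last exact: valP.
      by exists (exist _ x Px).
    exact: sub_countable (card_image_le _ _) Wcount.
  have [allP|/existsNP nallP] := pselect (forall x, P x).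
    apply: uncountable_set_nat; apply: sub_countable valcount.
    by apply: subset_card_le => x _; exact: allP.
  have [z nPz zmin] : exists2 z, [set x | ~ P x] z
      & forall w, [set x | ~ P x] w -> R z w.
    by apply: Rmin; case: nallP => x nPx; exists x.
  apply: nPz; apply/asboolP; apply: sub_countable valcount.
  apply: subset_card_le => y [yz Ryz] /=; apply: contrapT => /zmin Rzy.
  by rewrite (Ranti y z) ?eqxx ?Ryz in yz.
- move=> a; have /asboolP := valP (a : S); apply: sub_countable.
  rewrite -(card_le_eql (inj_card_eq (f := val) _)); last by move=> x y _ _ /val_inj.
  apply: subset_card_le => _ [b /andP[ab ba] <-]; split=> //.
  by rewrite eq_sym.
Qed.

(* Main.v *)
(** Let g n be the least w with F(n, _) <= w on a set of v_n, and let X in u be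
    such that g @` X has small order type. Minimality of g n allows us to choose
    B_n, an image under F(n, _) of a set of v_n, of small order type and lying
    below g n, but above each of the first n values of F and of g that are
    smaller than g n. In the gap below a point g k of g @` X, an initial segment
    strictly below g k then meets only finitely many B_n: those with n <= k, and
    those with g n = g k and n small. So the type of the union of the B_n, n in X,
    is bounded by means of the lexicographic order on triples (position of the
    gap, number N of sets that matter, rank in the union of B_0, ..., B_N). *)
Require Import Defs.
From Stdlib Require Import Relation_Operators Lexicographic_Product.
From mathcomp Require Import all_boot all_order.
From mathcomp Require Import boolp classical_sets functions cardinality filter.

Set Implicit Arguments.
Unset Strict Implicit.
Unset Printing Implicit Defensive.

Import Order.TTheory.

Local Open Scope classical_set_scope.
Local Open Scope order_scope.

(** * Least elements, countable bounds and ranks *)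

Lemma well_founded_least T (R : T -> T -> Prop) (Rwf : well_founded R)
    (P : set T) : P !=set0 -> exists2 w, P w & forall z, P z -> ~ R z w.
Proof.
move=> [x]; elim/(well_founded_ind Rwf): x => x IH Px.
have [[z [Pz zx]]|nz] := pselect (exists z, P z /\ R z x); first exact: IH zx Pz.
by exists x => // z Pz zx; apply: nz; exists z.
Qed.

Lemma omega1_least d (W : orderType d) (hW : is_omega1 W) (P : set W) :
  P !=set0 -> exists2 w, P w & forall z, P z -> w <= z.
Proof.
move=> /(well_founded_least (omega1_wf hW))[w Pw wmin].
by exists w => // z /wmin /negP; rewrite -leNgt.
Qed.

(** Without a strict bound, the closed initial segments at the points of [Y] would cover [W] by
    countably many countable sets. *)
Lemma countable_bounded d (W : orderType d) (hW : is_omega1 W) (Y : set W) :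
  countable Y -> exists w, forall y, Y y -> y < w.
Proof.
move=> Yc; apply: contrapT => nb; apply: (omega1_uncountable hW).
apply: (@sub_countable _ _ _ (\bigcup_(y in Y) ([set b | b < y] `|` [set y]))).
  apply: subset_card_le => w _; apply: contrapT => nw; apply: nb.
  exists w => y Yy; rewrite ltNge le_eqVlt; apply/negP => /orP[/eqP wy|wy].
    by apply: nw; exists y => //; right.
  by apply: nw; exists y => //; left.
apply: bigcup_countable => // y _.
have -> : [set b | b < y] `|` [set y]
    = \bigcup_(b in [set: bool]) (if b then [set b | b < y] else [set y]).
  apply/seteqP; split=> [x [xy|xy]|x [[] _ xy]]; [exists true|exists false|left|right] => //.
by apply: bigcup_countable => // -[] _ //; exact: omega1_initial.
Qed.

(* [rk x] is the least strict upper bound of the ranks of the predecessors of x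
   that lie in S; it is defined for x outside S too. *)
Definition is_rank d (W : orderType d) L (R : L -> L -> Prop) (S : set L)
    (rk : L -> W) : Prop :=
  (forall z x, S z -> R z x -> rk z < rk x) /\
  (forall x w, (forall z, S z -> R z x -> rk z < w) -> rk x <= w).

Lemma rank_exists d (W : orderType d) (hW : is_omega1 W) L (R : L -> L -> Prop)
    (Rwf : well_founded R) (S : set L) :
  (forall x, countable (S `&` [set z | R z x])) ->
  exists rk : L -> W, is_rank R S rk.
Proof.
move=> Sc.
(* [lst] takes an arbitrary value on the empty set; [ubd] shows that the recursion never meets this
   case. *)
have /choice[lst lstP] : forall P : set W, exists w,
    P !=set0 -> P w /\ forall z, P z -> w <= z.
  move=> P; have [/(omega1_least hW)[w Pw wmin]|P0] := pselect (P !=set0).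
    by exists w.
  by have [w _] := countable_bounded hW (countable0 W); exists w.
pose F x (rec : forall z, R z x -> W) : W :=
  lst [set w | forall z (zx : R z x), S z -> rec z zx < w].
pose rk := Fix Rwf (fun _ => W) F.
have rkE x : rk x = lst [set w | forall z, R z x -> S z -> rk z < w].
  rewrite /rk Fix_eq// => y f g fg; rewrite /F; congr lst.
  by apply/seteqP; split=> w /= fw z zy Sz; have := fw z zy Sz; rewrite fg.
have ubd x : [set w | forall z, R z x -> S z -> rk z < w] !=set0.
  have [|w rkw] := @countable_bounded _ _ hW (rk @` (S `&` [set z | R z x])).
    exact: sub_countable (card_image_le _ _) (Sc x).
  by exists w => z zx Sz; apply: rkw; exists z.
exists rk; split=> [z x Sz zx|x w rkw]; have [ltx lex] := lstP _ (ubd x).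
  by rewrite (rkE x); exact: ltx.
by rewrite rkE; apply: lex => z zx Sz; exact: rkw.
Qed.

Lemma set_rank_exists d (W : orderType d) (hW : is_omega1 W) (Y : set W) :
  exists rk : W -> W, is_rank (fun x y : W => x < y) Y rk.
Proof.
apply: (rank_exists hW (omega1_wf hW)) => x; apply: sub_countable (omega1_initial hW x).
by apply: subset_card_le => z [].
Qed.

Lemma set_rank_homo d (W : orderType d) (Y : set W) (rk : W -> W) :
  is_rank (fun x y : W => x < y) Y rk -> {homo rk : x y / x <= y}.
Proof.
by move=> [lt_rk rk_le] x y xy; apply: rk_le => z Yz zx;
  apply: lt_rk => //; exact: lt_le_trans xy.
Qed.

Lemma set_rank_le d (W : orderType d) (hW : is_omega1 W) (Y : set W)
    (rk h : W -> W) : is_rank (fun x y : W => x < y) Y rk ->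
  (forall x y, Y x -> Y y -> x < y -> h x < h y) ->
  forall y, Y y -> rk y <= h y.
Proof.
move=> [_ rk_le] hmono; elim/(well_founded_ind (omega1_wf hW)) => y IH Yy.
by apply: rk_le => z Yz zy; apply: le_lt_trans (IH z zy Yz) (hmono _ _ _ _ zy).
Qed.

(** * Bounding order types *)

(** The rank on [Y] is its collapse onto an ordinal and lies pointwise below [h]. The order type is
    the least value [g] that it misses, and [beta] is missed. *)
Lemma J_intro d (W : orderType d) (hW : is_omega1 W) (Y : set W) (h : W -> W)
    (alpha beta : W) : beta < alpha -> (forall y, Y y -> h y < beta) ->
  (forall x y, Y x -> Y y -> x < y -> h x < h y) -> J (Some alpha) Y.
Proof.
move=> ba hb hmono; have [rk rkP] := set_rank_exists hW Y.
have [lt_rk rk_le] := rkP.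
have rkb y : Y y -> rk y < beta.
  by move=> Yy; apply: le_lt_trans (hb _ Yy); exact: set_rank_le rkP hmono _ Yy.
have [|g ng gmin] := @omega1_least _ _ hW (~` (rk @` Y)).
  by exists beta => -[y Yy E]; have := rkb y Yy; rewrite E ltxx.
have gb : g <= beta.
  by apply: gmin => -[y Yy E]; have := rkb y Yy; rewrite E ltxx.
(* The ranks have no gaps: if [w] were missed, induction would keep the ranks of all predecessors of
   [y] below [w], whence [rk y <= w]. *)
have onto y : forall w, Y y -> w < rk y -> (rk @` Y) w.
  elim/(well_founded_ind (omega1_wf hW)): y => y IH w Yy wy.
  apply: contrapT => nw; suff : rk y <= w by rewrite leNgt wy.
  apply: rk_le => z Yz zy; rewrite ltNge le_eqVlt; apply/negP => /orP[/eqP wz|wz].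
    by apply: nw; exists z.
  by apply: nw; exact: IH zy _ Yz wz.
exists g; first exact: le_lt_trans ba.
exists rk.
  split=> [y Yy||w wg].
  - rewrite /= ltNge le_eqVlt; apply/negP => /orP[/eqP E|gy].
      by apply: ng; exists y.
    by apply: ng; exact: onto gy.
  - move=> x y; rewrite !inE => Yx Yy E.
    by have [xy|xy|//] := ltgtP x y;
      [have := lt_rk _ _ Yx xy|have := lt_rk _ _ Yy xy]; rewrite E ltxx.
  - by apply: contrapT => nw; have := gmin w nw; rewrite leNgt wg.
apply: le_mono_in => x y; rewrite !inE => Yx Yy xy; exact: lt_rk.
Qed.

(** On [Y] the rank stays below the type [beta]; elsewhere it may reach [beta], which is still less
    than [alpha]. *)
Lemma J_rank_lt d (W : orderType d) (hW : is_omega1 W) (Y : set W) (alpha : W)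
    (rk : W -> W) : J (Some alpha) Y -> is_rank (fun x y : W => x < y) Y rk ->
  forall x, rk x < alpha.
Proof.
move=> [beta ba [f [fim _ _] fmono]] rkP x; apply: le_lt_trans ba.
have fY y z : Y y -> Y z -> y < z -> f y < f z.
  by move=> Yy Yz yz; rewrite !ltNge fmono ?inE// -ltNge.
apply: (proj2 rkP) => z Yz _.
by apply: le_lt_trans (set_rank_le hW rkP fY Yz) (fim _ Yz).
Qed.

(** The ranks of the countable set [S] are bounded in [W], and composing [k] with the rank embeds
    [Y] below that bound. So [gamma] depends on [R] and [S] only. *)
Lemma J_embed d (W : orderType d) (hW : is_omega1 W) L (R : L -> L -> Prop)
    (Rwf : well_founded R) (S : set L) : countable S ->
  exists gamma : W, forall (Y : set W) (k : W -> L), (forall y, Y y -> S (k y)) ->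
    (forall x y, Y x -> Y y -> x < y -> R (k x) (k y)) -> J (Some gamma) Y.
Proof.
move=> Sc; have [|rk [lt_rk _]] := rank_exists hW Rwf (S := S).
  by move=> x; apply: sub_countable Sc; apply: subset_card_le => z [].
have [|b rkb] := @countable_bounded _ _ hW (rk @` S).
  exact: sub_countable (card_image_le _ _) Sc.
have [g bg] := countable_bounded hW (countable1 b).
exists g => Y k kS kmono; apply: (@J_intro _ _ hW Y (rk \o k) g b) => //=.
- exact: bg.
- by move=> y Yy; apply: rkb; exists (k y) => //; exact: kS.
- by move=> x y Yx Yy xy; apply: lt_rk; [exact: kS|exact: kmono].
Qed.

Lemma J_sub d (W : orderType d) (hW : is_omega1 W) (alpha alpha' : W)
    (Y Z : set W) : alpha <= alpha' -> Z `<=` Y -> J (Some alpha) Y ->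
  J (Some alpha') Z.
Proof.
move=> aa' ZY [beta ba [f [fim _ _] fmono]].
apply: (@J_intro _ _ hW _ f _ beta); first exact: lt_le_trans aa'.
  by move=> y /ZY /fim.
by move=> x y /ZY Yx /ZY Yy xy; rewrite !ltNge fmono ?inE// -ltNge.
Qed.

Lemma slexprod_le d (T : orderType d) B (leB : B -> B -> Prop)
    (x x' : T) (y y' : B) : x <= x' -> (x = x' -> leB y y') ->
  slexprod T B (fun a b => a < b) leB (x, y) (x', y').
Proof.
rewrite le_eqVlt => /orP[/eqP <- /(_ erefl)|xx' _]; first exact: right_slex.
exact: left_slex.
Qed.

(** The pair of ranks in [A] and in [B] increases lexicographically: leaving a point of [A] raises
    the first entry, leaving a point of [B] the second. *)
Lemma J_setU d (W : orderType d) (hW : is_omega1 W) (alpha beta : W) :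
  exists gamma : W, forall A B, J (Some alpha) A -> J (Some beta) B ->
    J (Some gamma) (A `|` B).
Proof.
have Wwf := omega1_wf hW.
have [|g gP] := @J_embed _ _ hW _ _ (wf_slexprod _ _ _ _ Wwf Wwf)
   ([set b | b < alpha] `*` [set b | b < beta]).
  by apply: countableX; exact: omega1_initial.
exists g => A B JA JB.
have [rA rAP] := set_rank_exists hW A; have [rB rBP] := set_rank_exists hW B.
apply: (gP _ (fun x => (rA x, rB x))) => [x _|x y ABx _ xy].
  by split; [exact: J_rank_lt rAP _|exact: J_rank_lt rBP _].
apply: slexprod_le; first by apply: set_rank_homo rAP _ _ (ltW xy).
move=> E; case: ABx => [Ax|Bx]; last exact: (proj1 rBP).
by have := proj1 rAP _ _ Ax xy; rewrite E ltxx.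
Qed.

Lemma J_bigcup_le d (W : orderType d) (hW : is_omega1 W) (alpha : nat -> W) :
  exists delta : W, forall B : nat -> set W, (forall n, J (Some (alpha n)) (B n)) ->
    forall n, J (Some delta) (\bigcup_(i in [set i | (i <= n)%N]) B i).
Proof.
have /choice[dl dlP] : forall n, exists dl : W, forall B : nat -> set W,
    (forall n, J (Some (alpha n)) (B n)) ->
    J (Some dl) (\bigcup_(i in [set i | (i <= n)%N]) B i).
  elim=> [|n [dl dlP]].
    exists (alpha 0) => B JB; apply: J_sub (JB 0) => //.
    by move=> x [i /=]; rewrite leqn0 => /eqP ->.
  have [g gP] := J_setU hW dl (alpha n.+1).
  exists g => B JB; apply: J_sub (gP _ _ (dlP B JB) (JB n.+1)) => //.
  move=> x [i /=]; rewrite leq_eqVlt => /orP[/eqP ->|lin] Bx; [by right|left].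
  by exists i.
have [|w dlw] := @countable_bounded _ _ hW (range dl).
  by apply: sub_countable (card_image_le _ _) _; exact: countableP.
exists w => B JB n; apply: J_sub (dlP n B JB) => //.
by apply: ltW; apply: dlw; exists n.
Qed.

(** * Sums and images of ultrafilters *)

Lemma ultra_ultrafilter_sum (u : set_system nat) (v : nat -> set_system nat) :
  UltraFilter u -> (forall n, UltraFilter (v n)) ->
  UltraFilter (ultrafilter_sum u v).
Proof.
move=> uU vU; have sumF : Filter (ultrafilter_sum u v).
  split=> [|P Q|P Q PQ]; rewrite /ultrafilter_sum /=.
  - by apply: filterS filterT => n _; exact: filterT.
  - by apply: filterS2 => n vP vQ; exact: filterI.
  - by apply: filterS => n; apply: filterS => m; exact: PQ.
split.
  split=> //; rewrite /ultrafilter_sum /= => s0.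
  apply: (@filter_not_empty _ u); apply: filterS s0 => n.
  exact: filter_not_empty.
move=> G GF sG; apply/seteqP; split=> // Z GZ; apply: contrapT => nsZ.
have sZC : ultrafilter_sum u v (~` Z).
  rewrite /ultrafilter_sum /=.
  have [//|] := in_ultra_setVsetC [set n | v n [set m | Z (n, m)]] uU.
  apply: filterS => n nvZ.
  by have [] := in_ultra_setVsetC [set m | Z (n, m)] (vU n).
by apply: (@filter_not_empty _ G); rewrite -(setICr Z); apply: filterI => //; exact: sG.
Qed.

Lemma ultra_fmap T U (f : T -> U) (F : set_system T) :
  UltraFilter F -> UltraFilter (fmap f F).
Proof.
move=> FU; split; first exact: fmap_proper_filter.
move=> G GF FG; apply/seteqP; split=> // A GA.
have [//|FA] := in_ultra_setVsetC (f @^-1` A) FU.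
by case: (@filter_not_empty _ G); rewrite -(setICr A); apply: filterI => //; exact: FG.
Qed.

(** * The order type of a union of trimmed sets *)

(** [gamma] comes before [F], since one ordinal has to serve all functions on the sum. *)
Lemma J_bigcup_trimmed d (W : orderType d) (hW : is_omega1 W) (alpha : W)
    (beta : nat -> W) :
  exists gamma : W, forall (F g : nat -> W) (X : set nat) (B : nat -> set W),
    J (Some alpha) (g @` X) -> (forall n, J (Some (beta n)) (B n)) ->
    (forall n, B n `<=` range F) ->
    (forall n x, B n x -> x <= g n) ->
    (forall n x j, B n x -> (j < n)%N -> F j < g n -> F j < x) ->
    (forall n x j, B n x -> (j < n)%N -> g j < g n -> g j < x) ->
    J (Some gamma) (\bigcup_(n in X) B n).
Proof.
have [dl dlP] := J_bigcup_le hW beta.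
have Wwf := omega1_wf hW.
have Nwf : well_founded (fun m n : nat => (m < n)%N).
  by move=> n; elim/ltn_ind: n => n IH; split.
have [|e eP] := @J_embed _ _ hW _ _
    (wf_slexprod _ _ _ _ Wwf (wf_slexprod _ _ _ _ Nwf Wwf))
   ([set b | b < alpha] `*` ([set: nat] `*` [set b | b < dl])).
  do 2?[apply: countableX] => //; exact: omega1_initial.
have [gm gmP] := J_setU hW alpha e.
exists gm => F g X B JG JB BF Bg BtF Btg.
set G := g @` X; pose U := \bigcup_(n in X) B n.
(* Points of [G] are set aside because a point outside [G] lies strictly below the end of its gap,
   leaving room for a separating [F j]. *)
suff JUG : J (Some e) (U `\` G).
  apply: J_sub (gmP _ _ JG JUG) => // x Ux.
  by have [Gx|nGx] := pselect (G x); [left|right].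
have [rG rGP] := set_rank_exists hW G.
have /choice[rB rBP] := fun N => set_rank_exists hW
  (\bigcup_(i in [set i | (i <= N)%N]) B i).
(* [P y N] bounds by N an index k such that g k is the end of the gap of y and
   the least j such that F j separates y from that end. *)
pose P y N := exists2 k, (k <= N)%N /\ X k
  & (exists2 j, (j <= N)%N & y <= F j < g k) /\
    forall n, X n -> y <= g n -> g k <= g n.
(* Here [g k] is the least point of [G] above [y], and [F j] is [y] itself. *)
have P_ex y : (U `\` G) y -> exists N, P y N.
  move=> [[n Xn By] nGy].
  have [|_ [[k Xk <-] ygk] gkmin] :=
      @omega1_least _ _ hW [set c | G c /\ y <= c].
    by exists (g n); split; [exists n|exact: Bg By].
  have [j _ Fj] := BF n y By.
  exists (maxn k j), k; first by rewrite leq_maxl.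
  split; last by move=> m Xm ym; apply: gkmin; split => //; exists m.
  exists j; first by rewrite leq_maxr.
  rewrite Fj lexx lt_neqAle ygk andbT; apply/eqP => E.
  by apply: nGy; rewrite E; exists k.
(* If [N < n], trimming applies to [j] and [k]: [g k = g n] forces [F j < y], and [g k < g n] forces
   [g k < y]. Both contradict [y <= F j < g k]. *)
have P_bound y N n : (U `\` G) y -> P y N -> X n -> B n y -> (n <= N)%N.
  move=> [_ nGy] [k [kN Xk] [[j jN /andP[yFj Fjgk]] kmin]] Xn By.
  rewrite leqNgt; apply/negP => Nn.
  have := kmin n Xn (Bg _ _ By); rewrite le_eqVlt => /orP[/eqP E|gkn].
    have := BtF n y j By (leq_ltn_trans jN Nn); rewrite -E => /(_ Fjgk).
    by rewrite ltNge yFj.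
  have := Btg n y k By (leq_ltn_trans kN Nn) gkn.
  by rewrite ltNge (le_trans yFj (ltW Fjgk)).
have /choice[N NP] : forall y, exists N, (U `\` G) y ->
    P y N /\ forall M, P y M -> (N <= M)%N.
  move=> y; have [UGy|] := pselect ((U `\` G) y); last by exists 0%N.
  have [N PN Nmin] := well_founded_least Nwf (P_ex y UGy).
  by exists N => _; split=> // M /Nmin /negP; rewrite -leqNgt.
apply: (eP _ (fun y => (rG y, (N y, rB (N y) y)))) => [y _|x y UGx UGy xy].
  split; first exact: J_rank_lt JG rGP _.
  by split=> //; exact: J_rank_lt (dlP _ JB _) (rBP _) _.
have [[n Xn Bx] nGx] := UGx.
apply: slexprod_le => [|EG]; first exact: set_rank_homo rGP _ _ (ltW xy).
(* Equal ranks in [G] mean that no point of [G] lies in the interval from [x] up to but excluding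
   [y]. *)
have gap m : X m -> x <= g m -> y <= g m.
  move=> Xm xm; rewrite leNgt; apply/negP => my.
  have := proj1 rGP (g m) y (ex_intro2 _ _ m Xm erefl) my.
  by rewrite -EG ltNge (set_rank_homo rGP).
apply: slexprod_le => [|EN].
  (* The indices [k] and [j] that serve [y] serve [x] too, as [x < y] share a gap; minimality of
     [N x] concludes. *)
  apply: (proj2 (NP x UGx)).
  have [[k kX [[j jN /andP[yFj Fjgk]] kmin]] _] := NP y UGy.
  exists k => //; split; last by move=> m Xm /(gap m Xm); exact: kmin.
  by exists j => //; rewrite (le_trans (ltW xy) yFj).
(* Both ranks now refer to the same finite union, which contains [x] by [P_bound]. *)
rewrite -EN; apply: (proj1 (rBP _)) => //.
by exists n => //; exact: P_bound UGx (proj1 (NP x UGx)) Xn Bx.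
Qed.

(** * Trimming sets of the ultrafilters [v n] *)

Theorem theorem4p8 (d : Order.disp_t) (W : orderType d) (hW : is_omega1 W)
    (u : set_system nat) (v : nat -> set_system nat)
    (hu : classC W u) (hv : forall n : nat, classC W (v n))
    (phi : nat * nat -> nat) (hphi : bijective phi) :
  classC W (fmap phi (ultrafilter_sum u v)).
Proof.
have [alpha [uU uJ]] := hu; have /choice[beta vJ] := hv.
have vU n : UltraFilter (v n) by case: (vJ n).
have [gm gmP] := J_bigcup_trimmed hW alpha beta.
exists gm; split; first by apply: ultra_fmap; exact: ultra_ultrafilter_sum.
move=> F; pose f n m := F (phi (n, m)).
have /choice[A AP] n : exists A, v n A /\ J (Some (beta n)) (f n @` A).
  by have [A vA JA] := proj2 (vJ n) (f n); exists A.
have /choice[g gP] n : exists g, v n [set m | f n m <= g] /\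
    forall w, v n [set m | f n m <= w] -> g <= w.
  have [|w vw wmin] := @omega1_least _ _ hW [set w | v n [set m | f n m <= w]].
    have [|b fb] := @countable_bounded _ _ hW (range (f n)).
      by apply: sub_countable (card_image_le _ _) _; exact: countableP.
    exists b; apply: filterS filterT => m _ /=; apply: ltW; apply: fb.
    by exists m.
  by exists w.
have [X uX JX] := uJ g.
(* For each [n] these are finitely many conditions, so imposing them on [f n m] leaves a set of
   [v n]. *)
pose cut n x := forall c j, (j < n)%N -> c = F j \/ c = g j -> c < g n -> c < x.
pose B n := [set x | [/\ (f n @` A n) x, x <= g n & cut n x]].
(* By minimality of [g n] the complement is not in [v n]. *)
have trim n c : c < g n -> v n [set m | c < f n m].
  move=> cg; have [|vc] := in_ultra_setVsetC [set m | f n m <= c] (vU n).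
    by move/(proj2 (gP n)); rewrite leNgt cg.
  by apply: filterS vc => m /= /negP; rewrite -ltNge.
have vcut n : v n [set m | cut n (f n m)].
  have vc (c : nat -> W) k :
      v n [set m | forall j, (j < k)%N -> c j < g n -> c j < f n m].
    elim: k => [|k IH]; first by apply: filterS filterT.
    have vk : v n [set m | c k < g n -> c k < f n m].
      have [/trim|nckg] := pselect (c k < g n); last first.
        by apply: filterS filterT => m _.
      by apply: filterS => m cf _.
    apply: filterS2 IH vk => m IH ck j.
    by rewrite ltnS leq_eqVlt => /orP[/eqP ->|]; [exact: ck|exact: IH].
  apply: filterS2 (vc F n) (vc g n) => m Fm gm' c j jn [->|->].
    exact: Fm.
  exact: gm'.
(* The image of this preimage lies inside the union, so the bound for the union passes to it. *)
exists (F @^-1` \bigcup_(n in X) B n).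
  apply: filterS uX => n Xn; apply: filterS (filterI (proj1 (AP n))
    (filterI (proj1 (gP n)) (vcut n))) => m [Am [fg cm]].
  by exists n => //; split=> //; exists m.
apply: J_sub (gmP F g X B JX _ _ _ _ _) => //.
- by move=> _ [k ? <-].
- by move=> n; apply: J_sub (proj2 (AP n)) => // x [].
- by move=> n x [[m _ <-] _ _]; exists (phi (n, m)).
- by move=> n x [].
- by move=> n x j [_ _ cx] jn; apply: cx jn _; left.
- by move=> n x j [_ _ cx] jn; apply: cx jn _; right.
Qed.
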